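(* The set $\mathbf{CP}_{\mathfrak{sl}(2,\mathbb{C})}$ of characteristic polynomials of all finite-dimensional complex representations of $\mathfrak{sl}(2,\mathbb{C})$ is a commutative monoid under the resolution product $*$, with unit element $z_0$.
   Context: $\mathfrak{sl}(2,\mathbb{C})$ is the Lie algebra of traceless $2\times 2$ complex matrices with basis $h=\begin{pmatrix}1&0\\0&-1\end{pmatrix}$, $e_1=\begin{pmatrix}0&1\\0&0\end{pmatrix}$, $e_2=\begin{pmatrix}0&0\\1&0\end{pmatrix}$. For a finite-dimensional complex representation $\phi$ of $\mathfrak{sl}(2,\mathbb{C})$, its characteristic polynomial is $$f_{\phi}(z_0,z_1,z_2,z_3)=\det\left(z_0 I+z_1\phi(h)+z_2\phi(e_1)+z_3\phi(e_2)\right),$$ and $\mathbf{CP}_{\mathfrak{sl}(2,\mathbb{C})}\subset\mathbb{C}[z_0,z_1,z_2,z_3]$ is the set of all such $f_\phi$. Resolution product: given $f_\phi,f_\psi\in\mathbf{CP}_{\mathfrak{sl}(2,\mathbb{C})}$, one can write, in $\mathbb{C}[\sqrt{z_1^2+z_2z_3},z_0,z_1,z_2,z_3]$, $$f_{\phi}=\prod_{i=1}^{n}\left(z_0+\alpha_i\sqrt{z_1^{2}+z_2z_3}\right),\qquad f_{\psi}=\prod_{j=1}^{m}\left(z_0+\beta_j\sqrt{z_1^{2}+z_2z_3}\right),$$ where $\alpha_1,\dots,\alpha_n$ are all the eigenvalues of $\phi(h)$ and $\beta_1,\dots,\beta_m$ are all the eigenvalues of $\psi(h)$, counted with multiplicity.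 The resolution product is $$f_{\phi}*f_{\psi}=\prod_{i=1}^{n}\prod_{j=1}^{m}\left(z_0+(\alpha_i+\beta_j)\sqrt{z_1^{2}+z_2z_3}\right)\in\mathbb{C}[\sqrt{z_1^2+z_2z_3},z_0,z_1,z_2,z_3].$$ *)

(* Defs.v *)
From HB Require Import structures.
From mathcomp Require Import all_boot all_order all_algebra.
From mathcomp Require Import classical_sets reals complex mpoly.

Set Implicit Arguments.
Unset Strict Implicit.
Unset Printing Implicit Defensive.

Import GRing.Theory.
Local Open Scope ring_scope.
Local Open Scope complex_scope.
Local Open Scope classical_set_scope.

Definition commutator (R : realType) (n : nat) (A B : 'M[R[i]]_n) : 'M[R[i]]_n :=
  A *m B - B *m A.

Definition traceless (R : realType) (A : 'M[R[i]]_2) : bool := \tr A == 0.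

Fact traceless_submod_closed (R : realType) : submod_closed (@traceless R).
Proof.
split=> [|a A B]; rewrite /in_mem /= /traceless ?mxtrace0 //.
by move=> /eqP trA /eqP trB; rewrite mxtraceD mxtraceZ trA trB mulr0 addr0.
Qed.

HB.instance Definition _ (R : realType) :=
  GRing.isSubmodClosed.Build R[i] 'M[R[i]]_2 (@traceless R)
    (traceless_submod_closed R).

Record sl2 (R : realType) := Sl2 {
  sl2_mx :> 'M[R[i]]_2;
  sl2_mxP : traceless sl2_mx
}.

HB.instance Definition _ (R : realType) := [isSub for @sl2_mx R].
HB.instance Definition _ (R : realType) := [Choice of sl2 R by <:].
HB.instance Definition _ (R : realType) :=
  [SubChoice_isSubLmodule of sl2 R by <:].

Fact commutator_traceless (R : realType) (A B : 'M[R[i]]_2) :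
  traceless (commutator A B).
Proof. by rewrite /traceless /commutator linearB /= mxtrace_mulC subrr. Qed.

Definition lie_bracket (R : realType) (x y : sl2 R) : sl2 R :=
  Sl2 (commutator_traceless x y).

Fact sl2_h_traceless (R : realType) :
  traceless (delta_mx 0 0 - delta_mx 1 1 : 'M[R[i]]_2).
Proof.
by rewrite /traceless /mxtrace !big_ord_recl big_ord0 !mxE !eqE /=
           ?(subr0, sub0r, addr0) subrr.
Qed.

Fact sl2_e1_traceless (R : realType) : traceless (delta_mx 0 1 : 'M[R[i]]_2).
Proof. by rewrite /traceless /mxtrace !big_ord_recl big_ord0 !mxE !eqE /= !addr0. Qed.

Fact sl2_e2_traceless (R : realType) : traceless (delta_mx 1 0 : 'M[R[i]]_2).
Proof. by rewrite /traceless /mxtrace !big_ord_recl big_ord0 !mxE !eqE /= !addr0. Qed.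

Definition sl2_h (R : realType) : sl2 R := Sl2 (sl2_h_traceless R).
Definition sl2_e1 (R : realType) : sl2 R := Sl2 (sl2_e1_traceless R).
Definition sl2_e2 (R : realType) : sl2 R := Sl2 (sl2_e2_traceless R).

(* A representation on C^n; the dimension n = 0 is allowed, and its
   characteristic polynomial is the constant 1. *)
Record sl2_rep (R : realType) (n : nat) := Sl2Rep {
  rep_map :> {linear sl2 R -> 'M[R[i]]_n};
  rep_bracket : forall x y : sl2 R,
    rep_map (lie_bracket x y) = commutator (rep_map x) (rep_map y)
}.

Definition z0 (R : realType) : {mpoly R[i][4]} := 'X_(@Ordinal 4 0 isT).
Definition z1 (R : realType) : {mpoly R[i][4]} := 'X_(@Ordinal 4 1 isT).
Definition z2 (R : realType) : {mpoly R[i][4]} := 'X_(@Ordinal 4 2 isT).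
Definition z3 (R : realType) : {mpoly R[i][4]} := 'X_(@Ordinal 4 3 isT).

Definition rep_char_poly (R : realType) (n : nat) (phi : sl2_rep R n) :
    {mpoly R[i][4]} :=
  let lift A := map_mx (@mpolyC 4 R[i]) A in
  \det ((z0 R)%:M + z1 R *: lift (phi (sl2_h R)) + z2 R *: lift (phi (sl2_e1 R))
        + z3 R *: lift (phi (sl2_e2 R))).

Definition CP (R : realType) : set {mpoly R[i][4]} :=
  [set f | exists (n : nat) (phi : sl2_rep R n), f = rep_char_poly phi].

Arguments CP R : clear implicits.

(* C[sqrt(z1^2 + z2 z3), z0, z1, z2, z3] is realized as the quotient
   C[z0, z1, z2, z3][s] / (s^2 - (z1^2 + z2 z3)); since z1^2 + z2 z3 is not a
   square, s^2 - (z1^2 + z2 z3) is irreducible and s is a genuine square root. *)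
Definition sqrt_modulus (R : realType) : {poly {mpoly R[i][4]}} :=
  'X^2 - (z1 R ^+ 2 + z2 R * z3 R)%:P.

(* {poly %/ p} falls back on the modulus 'X when p is not monic of positive
   degree; this is not the case here. *)
Fact mk_monic_sqrt_modulus (R : realType) :
  mk_monic (sqrt_modulus R) = sqrt_modulus R.
Proof. by rewrite /mk_monic /sqrt_modulus size_XnsubC ?monicXnsubC. Qed.

Notation sqrt_ring R := {poly %/ sqrt_modulus R}.

Definition sqrt_ring_embed (R : realType) (f : {mpoly R[i][4]}) : sqrt_ring R :=
  in_qpoly (sqrt_modulus R) f%:P.

Definition sqrt_gen (R : realType) : sqrt_ring R := in_qpoly (sqrt_modulus R) 'X.

Definition linear_factor (R : realType) (a : R[i]) : sqrt_ring R :=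
  sqrt_ring_embed (z0 R) + sqrt_ring_embed a%:MP * sqrt_gen R.

Definition resolution (R : realType) (f : {mpoly R[i][4]}) (alpha : seq R[i]) :
    Prop :=
  exists (n : nat) (phi : sl2_rep R n),
    [/\ f = rep_char_poly phi,
        char_poly (phi (sl2_h R)) = \prod_(a <- alpha) ('X - a%:P) &
        sqrt_ring_embed f = \prod_(a <- alpha) linear_factor a].

(* A relation rather than a function: that p depends only on f and g, and not on
   the chosen representations, is part of what has to be proved. *)
Definition is_resolution_product (R : realType) (f g : {mpoly R[i][4]})
    (p : sqrt_ring R) : Prop :=
  exists alpha beta : seq R[i],
    [/\ resolution f alpha, resolution g beta &
        p = \prod_(a <- alpha) \prod_(b <- beta) linear_factor (a + b)].

(* Main.v *)
Require Import Defs.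
From HB Require Import structures.
From mathcomp Require Import all_boot all_order all_algebra.
From mathcomp Require Import boolp classical_sets reals complex mpoly.
From mathcomp Require Import mxtens ring.

Set Implicit Arguments.
Unset Strict Implicit.
Unset Printing Implicit Defensive.

Import GRing.Theory Num.Theory.
Local Open Scope ring_scope.
Local Open Scope complex_scope.

(** Let H, E, F be the images of h, e1, e2 under a representation phi.  The
    whole theorem rests on the factorization of the characteristic polynomial
    of phi as the product of the z0 + a s, where a runs over the eigenvalues of
    H and s is the square root of z1^2 + z2 z3 ([embed_rep_char_poly]).  A
    characteristic polynomial and the spectrum of H, as a multiset, then carry
    the same information: the factorization gives one direction, and
    z0 := X, z1 := -1, z2 := z3 := 0 turns the determinant into the
    characteristic polynomial of H ([char_poly_of_rep_char_poly]).  On spectra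
    the resolution product is the multiset of all sums a + b, which is
    the spectrum of the tensor product ([char_poly_kronecker_sum]); so the
    product is well defined and stays in the set, and associativity,
    commutativity and the unit (the trivial representation, with spectrum {0})
    come from addition of complex numbers.

    The factorization expresses that z1 h + z2 e1 + z3 e2 is conjugate to s h.
    Instead of exponentiating E and F, one uses Lax pairs: if a polynomial
    family of matrices M(t) satisfies M' = [M, A], then Jacobi's formula for
    the derivative of a determinant shows that det M(t) is constant
    ([lax_det_constant]).  Two such families, one along ad e1 and one along
    ad e2, lead from z0 + z1 H + z2 E + z3 F to z0 + s H at every complex point
    where z3 and s do not vanish ([det_pencil_straighten]).  These points are
    numerous enough to separate the elements of the quadratic extension by s
    ([sqrt_ring_separated]), so that the identity holds there formally. *)

(** * Isospectral families of matrices *)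

Lemma deriv_prod_ord (K : comNzRingType) n (F : 'I_n -> {poly K}) :
  (\prod_i F i)^`() = \sum_k \prod_i (if i == k then (F i)^`() else F i).
Proof.
elim: n F => [|n IHn] F; first by rewrite !big_ord0 derivC.
rewrite big_ord_recl derivM IHn big_ord_recl; congr (_ + _).
  by rewrite big_ord_recl.
rewrite mulr_sumr; apply: eq_bigr => k _.
by rewrite big_ord_recl.
Qed.

(** Jacobi's formula: differentiating the Leibniz expansion replaces one row at
    a time by its derivative, and expanding along that row produces the
    cofactors. *)
Lemma deriv_det (K : comNzRingType) n (M : 'M[{poly K}]_n) :
  (\det M)^`() = \tr (\adj M *m map_mx (@deriv K) M).
Proof.
(* N k is M with its row k replaced by the derivative of that row. *)
pose N k := \matrix_(i, j) (if i == k then (M i j)^`() else M i j).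
transitivity (\sum_k \det (N k)).
  rewrite exchange_big /= raddf_sum; apply: eq_bigr => s _ /=.
  rewrite -signr_odd; case: (odd _); rewrite ?(expr1, expr0, mulN1r, mul1r).
    rewrite derivN deriv_prod_ord -sumrN; apply: eq_bigr => k _.
    by rewrite mulN1r; congr (- _); apply: eq_bigr => i _; rewrite !mxE.
  rewrite deriv_prod_ord; apply: eq_bigr => k _.
  by rewrite mul1r; apply: eq_bigr => i _; rewrite !mxE.
rewrite mxtrace_mulC; apply: eq_bigr => k _.
rewrite (expand_det_row _ k) mxE; apply: eq_bigr => j _.
rewrite !mxE eqxx; congr (_ * (_ * \det _)).
apply/matrixP => i l; rewrite !mxE eq_sym.
by rewrite (negbTE (neq_lift _ _)).
Qed.

Lemma deriv_eq0_horner (K : numDomainType) (p : {poly K}) a b :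
  p^`() = 0 -> p.[a] = p.[b].
Proof.
move=> p'0; suff -> : p = (p`_0)%:P by rewrite !hornerC.
apply/polyP => -[|i]; rewrite coefC //=.
have /eqP := coef_deriv p i; rewrite p'0 coef0 eq_sym mulrn_eq0 => /eqP.
exact.
Qed.

(** In Jacobi's formula the adjugate turns M into the scalar det M on either
    side of A, so both terms of the commutator contribute det M * tr A. *)
Lemma lax_det_constant (K : numDomainType) n (M A : 'M[{poly K}]_n) a b :
  map_mx (@deriv K) M = M *m A - A *m M ->
  (\det M).[a] = (\det M).[b].
Proof.
move=> lax; apply: deriv_eq0_horner.
rewrite deriv_det lax mulmxBr linearB /= !mulmxA mul_adj_mx.
by rewrite [X in _ - X]mxtrace_mulC mulmxA mul_mx_adj subrr.
Qed.

(** * Pencils of sl2 triples *)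

Definition pencil (K : comNzRingType) n (H E F : 'M[K]_n) (c0 c1 c2 c3 : K) :=
  c0%:M + c1 *: H + c2 *: E + c3 *: F.

Lemma pencil_commE (K : comNzRingType) n (H E F : 'M[K]_n) c0 c1 c2 c3 :
    H *m E - E *m H = 2 *: E -> E *m F - F *m E = H ->
  pencil H E F c0 c1 c2 c3 *m E - E *m pencil H E F c0 c1 c2 c3 =
  (2 * c1) *: E - c3 *: H.
Proof.
move=> HE EF; rewrite -[H in RHS]EF mulrC -[(c1 * _) *: E]scalerA -HE /pencil.
rewrite !mulmxDl !mulmxDr -!scalemxAl -!scalemxAr scalar_mxC.
by apply/matrixP=> i j; rewrite ![in LHS]mxE ![in RHS]mxE; ring.
Qed.

Lemma pencil_commF (K : comNzRingType) n (H E F : 'M[K]_n) c0 c1 c2 c3 :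
    H *m F - F *m H = - 2 *: F -> E *m F - F *m E = H ->
  pencil H E F c0 c1 c2 c3 *m F - F *m pencil H E F c0 c1 c2 c3 =
  c2 *: H - (2 * c1) *: F.
Proof.
move=> HF EF; rewrite -[H in RHS]EF -scaleNr.
rewrite (_ : - (2 * c1) = c1 * - 2); last by ring.
rewrite -[(c1 * _) *: F]scalerA -HF /pencil.
rewrite !mulmxDl !mulmxDr -!scalemxAl -!scalemxAr scalar_mxC.
by apply/matrixP=> i j; rewrite ![in LHS]mxE ![in RHS]mxE; ring.
Qed.

Lemma map_pencil (K L : comNzRingType) (f : {rmorphism K -> L}) n
    (H E F : 'M[K]_n) c0 c1 c2 c3 :
  map_mx f (pencil H E F c0 c1 c2 c3) =
  pencil (map_mx f H) (map_mx f E) (map_mx f F) (f c0) (f c1) (f c2) (f c3).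
Proof. by rewrite /pencil !map_mxD /= map_scalar_mx !map_mxZ. Qed.

Lemma deriv_pencil (K : comNzRingType) n (H E F : 'M[K]_n) c0 p1 p2 p3 :
  map_mx (@deriv K) (pencil (map_mx polyC H) (map_mx polyC E)
    (map_mx polyC F) c0%:P p1 p2 p3) =
  p1^`() *: map_mx polyC H + p2^`() *: map_mx polyC E
  + p3^`() *: map_mx polyC F.
Proof.
apply/matrixP=> i j; rewrite !mxE !derivE.
by rewrite mul0rn add0r !mulr0 !addr0.
Qed.

Lemma det_pencil_horner (K : comNzRingType) n (H E F : 'M[K]_n) p0 p1 p2 p3 a :
  (\det (pencil (map_mx polyC H) (map_mx polyC E) (map_mx polyC F)
           p0 p1 p2 p3)).[a] =
  \det (pencil H E F p0.[a] p1.[a] p2.[a] p3.[a]).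
Proof.
have evalC (X : 'M[K]_n) : map_mx (horner_eval a) (map_mx polyC X) = X.
  by apply/matrixP=> i j; rewrite !mxE /= horner_evalE hornerC.
by rewrite -horner_evalE -det_map_mx map_pencil !evalC.
Qed.

(** The element c1 h + c2 e1 + c3 e2 of the Lie algebra is moved to r h by
    exp (t ad e1), which removes e1 at the cost of shifting the coefficient of
    h from c1 to r, and then by exp (u ad e2), which removes e2.  Both
    one-parameter groups are polynomial in the parameter on the
    three-dimensional algebra, so that the moved pencil solves a Lax equation
    over polynomials. *)
Lemma det_pencil_straighten (K : numFieldType) n (H E F : 'M[K]_n)
    c0 c1 c2 c3 r :
    H *m E - E *m H = 2 *: E -> H *m F - F *m H = - 2 *: F ->
    E *m F - F *m E = H ->
    c3 != 0 -> r != 0 -> r ^+ 2 = c1 ^+ 2 + c2 * c3 ->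
  \det (pencil H E F c0 c1 c2 c3) = \det (c0%:M + r *: H).
Proof.
move=> HE HF EF c3n0 rn0 rE.
have liftB (X Y Z : 'M[K]_n) : X *m Y - Y *m X = Z ->
    map_mx polyC X *m map_mx polyC Y - map_mx polyC Y *m map_mx polyC X =
    map_mx polyC Z.
  by move=> <-; rewrite -!map_mxM -map_mxB.
have := liftB _ _ _ HE; rewrite map_mxZ rmorphMn => HEp.
have := liftB _ _ _ HF; rewrite map_mxZ rmorphN rmorphMn => HFp.
have EFp := liftB _ _ _ EF.
set H' := map_mx polyC H in HEp HFp EFp *.
set E' := map_mx polyC E in HEp HFp EFp *.
set F' := map_mx polyC F in HEp HFp EFp *.
transitivity (\det (pencil H E F c0 r 0 c3)).
  (* First flow: exp (t ad e1) adds t c3 to the coefficient of h, so this t is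
     the time at which that coefficient equals r; as it preserves z1^2 + z2 z3,
     the coefficient of e1 is then zero. *)
  pose t := (r - c1) / c3.
  pose p1 := c1%:P + c3%:P * 'X.
  pose p2 := c2%:P - (2 * c1)%:P * 'X - c3%:P * 'X ^+ 2.
  pose D := \det (pencil H' E' F' c0%:P p1 p2 c3%:P).
  transitivity D.[0].
    rewrite det_pencil_horner.
    have -> : p1.[0] = c1 by rewrite /p1 !hornerE.
    have -> : p2.[0] = c2 by rewrite /p2 !hornerE /=; ring.
    by rewrite !hornerE.
  transitivity D.[t].
    apply: (@lax_det_constant _ _ _ (- E')).
    rewrite deriv_pencil mulmxN mulNmx -opprD pencil_commE //.
    rewrite /p1 /p2 !derivE; apply/matrixP=> i j.
    by rewrite ![in LHS]mxE ![in RHS]mxE !rmorphM !rmorphMn /=; ring.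
  rewrite det_pencil_horner.
  have -> : p1.[t] = r by rewrite /p1 /t !hornerE /=; field.
  have -> : p2.[t] = 0.
    apply: (mulIf c3n0); rewrite mul0r -[RHS](subrr (r ^+ 2)) [in X in X - _]rE.
    by rewrite /p2 /t !hornerE /=; field.
  by rewrite !hornerE.
(* Second flow, rescaled so that time runs from 0 to 1: commuting r h with a e2
   gives - 2 r a e2, which must equal - c3 e2, the derivative of
   (1 - t) c3 e2. *)
pose D := \det (pencil H' E' F' c0%:P r%:P 0 (c3%:P * (1 - 'X))).
transitivity D.[0].
  by rewrite det_pencil_horner !hornerE subr0 mulr1.
pose a := c3 / (2 * r); have c3E : c3 = 2 * r * a by rewrite /a; field.
transitivity D.[1].
  apply: (@lax_det_constant _ _ _ (a%:P *: F')).
  rewrite deriv_pencil -scalemxAl -scalemxAr -scalerBr pencil_commF //.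
  rewrite !derivE; apply/matrixP=> i j; move: a c3E => a ->.
  by rewrite ![in LHS]mxE ![in RHS]mxE !rmorphM !rmorphMn /=; ring.
rewrite det_pencil_horner /pencil !hornerE /= subrr mulr0 !scale0r.
by rewrite !addr0.
Qed.

(** * Points of the quadratic extension *)

Lemma mpoly_poly_eq0 (K : numFieldType) n (q : {poly {mpoly K[n]}}) :
  (forall c : K, q.[c%:MP] = 0) -> q = 0.
Proof.
move=> q0; apply/eqP/negPn/negP=> qn0.
pose rs : seq {mpoly K[n]} := [seq (j%:R : K)%:MP | j <- iota 0 (size q)].
have rs_roots : all (root q) rs.
  by apply/allP=> _ /mapP[j _ ->]; apply/eqP/q0.
have rs_uniq : uniq rs.
  rewrite map_inj_in_uniq ?iota_uniq // => j k _ _.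
  move/(can_inj (mevalC (fun=> 0))).
  by move/eqP; rewrite eqr_nat => /eqP.
have := max_poly_roots qn0 rs_roots rs_uniq.
by rewrite size_map size_iota ltnn.
Qed.

Lemma rmorph_mmap (n : nat) (K S T : nzRingType) (g : {rmorphism S -> T})
    (f : K -> S) (h : 'I_n -> S) (p : {mpoly K[n]}) :
  g (mmap f h p) = mmap (g \o f) (g \o h) p.
Proof.
rewrite /mmap rmorph_sum; apply: eq_bigr => m _.
rewrite rmorphM /mmap1 rmorph_prod; congr (_ * _).
by apply: eq_bigr => i _; rewrite rmorphXn.
Qed.

Lemma eq_mmap (n : nat) (K S : nzRingType) (f f' : K -> S)
    (h h' : 'I_n -> S) p :
  f =1 f' -> h =1 h' -> mmap f h p = mmap f' h' p.
Proof.
move=> ff hh; apply: eq_bigr => m _; rewrite ff; congr (_ * _).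
by apply: eq_bigr => i _; rewrite hh.
Qed.

(** Values are substituted for the variables one at a time: [spec k v] keeps the
    first k variables and specializes the others.  Freeing one more variable
    preserves vanishing, because a univariate polynomial that vanishes at all
    constants is zero. *)
Lemma mpoly_eq0_meval (K : numFieldType) n (p : {mpoly K[n]}) :
  (forall v, p.@[v] = 0) -> p = 0.
Proof.
move=> p0.
pose spec k (v : 'I_n -> K) : {mpoly K[n]} :=
  mmap (@mpolyC n K) (fun i => if (i < k)%N then 'X_i else (v i)%:MP) p.
have spec0 k v : (k <= n)%N -> spec k v = 0.
  elim: k v => [|k IHk] v ltkn.
    rewrite -(mpolyC0 n K) -(p0 v) /meval rmorph_mmap.
    exact: eq_mmap.
  pose k' := Ordinal ltkn.
  pose q : {poly {mpoly K[n]}} := mmap (polyC \o @mpolyC n K)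
    (fun i : 'I_n => if (i < k)%N then ('X_i)%:P else
       if i == k' then 'X else (v i)%:MP%:P) p.
  have qE x : q.[x] = mmap (@mpolyC n K)
    (fun i : 'I_n => if (i < k)%N then 'X_i else
       if i == k' then x else (v i)%:MP) p.
    rewrite -horner_evalE rmorph_mmap; apply: eq_mmap => [c|i] /=.
      by rewrite horner_evalE hornerC.
    by do 2?case: ifP => _; rewrite horner_evalE ?hornerC ?hornerX.
  have q0 : q = 0.
    apply: mpoly_poly_eq0 => c.
    rewrite qE -[RHS](IHk (fun i => if i == k' then c else v i) (ltnW ltkn)).
    by apply: eq_mmap => // i; case: ifP => // _; case: ifP.
  rewrite -(horner0 'X_k') -q0 qE; apply: eq_mmap => // i.
  rewrite ltnS leq_eqVlt -(inj_eq val_inj) /=.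
  case: eqP => [ik|_]; last by [].
  by rewrite ik ltnn /=; congr 'X_ _; apply/val_inj.
rewrite -(spec0 n (fun=> 0) (leqnn n)) [LHS]mpolyE; apply: eq_bigr => m _.
rewrite -mul_mpolyC mpolyXE_id; congr (_ * _).
by apply: eq_bigr => i _; rewrite ltn_ord.
Qed.

(** An element of the extension has a representative t0 + t1 s.  At a point of
    the base both square roots r and - r of z1^2 + z2 z3 are available, so
    t0 + t1 r = t0 - t1 r = 0 kills both coefficients wherever z3 and the
    discriminant do not vanish; multiplying by these two nonzero polynomials
    makes the coefficients vanish everywhere. *)
Lemma sqrt_ring_separated (R : realType) (P Q : {poly {mpoly R[i][4]}}) :
  (forall v r, (z3 R).@[v] != 0 -> r != 0 ->
     r ^+ 2 = (z1 R ^+ 2 + z2 R * z3 R).@[v] ->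
     (map_poly (meval v) P).[r] = (map_poly (meval v) Q).[r]) ->
  in_qpoly (sqrt_modulus R) P = in_qpoly (sqrt_modulus R) Q.
Proof.
set d := z1 R ^+ 2 + _ => PQ; apply/eqP; rewrite -subr_eq0 -rmorphB; apply/eqP.
apply: val_inj; rewrite /= mk_monic_sqrt_modulus.
have mmon : sqrt_modulus R \is monic by rewrite monicXnsubC.
have := Pdiv.RingMonic.rdivp_eq mmon (P - Q).
have := Pdiv.Ring.ltn_rmodpN0 (P - Q) (monic_neq0 mmon).
set q := Pdiv.Ring.rdivp _ _; set s := Pdiv.Ring.rmodp _ _.
rewrite size_XnsubC // => ss PQE.
have sE v r : (map_poly (meval v) s).[r] = (s`_0).@[v] + (s`_1).@[v] * r.
  rewrite (@horner_coef_wide _ 2) ?(leq_trans (size_poly _ _)) //.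
  by rewrite !big_ord_recl big_ord0 !coef_map expr0 mulr1 addr0.
have s0 v r : (z3 R).@[v] != 0 -> r != 0 -> r ^+ 2 = d.@[v] ->
    (s`_0).@[v] + (s`_1).@[v] * r = 0.
  move=> z3n0 rn0 rE; rewrite -sE.
  have -> : s = P - Q - q * sqrt_modulus R by rewrite PQE addrC addKr.
  rewrite !rmorphB rmorphM /= !hornerE PQ // subrr sub0r.
  rewrite /sqrt_modulus rmorphB /= map_polyXn map_polyC !hornerE /=.
  by rewrite -/d -rE subrr mulr0 oppr0.
have dn0 : d != 0.
  apply/eqP => /(congr1 (meval (fun i : 'I_4 => (i == 1 :> nat)%:R))).
  rewrite raddf0 /d /z1 /z2 /z3 rmorphD rmorphXn rmorphM /= !mevalXU /=.
  by rewrite mulr0 addr0 expr1n => /eqP; rewrite oner_eq0.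
have z3n0 : z3 R != 0.
  apply/eqP => /(congr1 (meval (fun=> 1))).
  by rewrite raddf0 mevalXU => /eqP; rewrite oner_eq0.
have s01 v : (z3 R).@[v] != 0 -> d.@[v] != 0 ->
    (s`_0).@[v] = 0 /\ (s`_1).@[v] = 0.
  move=> z3v dv; set r := sqrtC (d.@[v]).
  have rn0 : r != 0 by rewrite sqrtC_eq0.
  have rE : r ^+ 2 = d.@[v] by rewrite sqrtCK.
  have e1 := s0 _ _ z3v rn0 rE.
  have := s0 v (- r) z3v; rewrite oppr_eq0 sqrrN => /(_ rn0 rE) e2.
  have s0' : (s`_0).@[v] = 0.
    apply: (@mulIf _ (2 : R[i])); first by rewrite pnatr_eq0.
    by rewrite mul0r -[RHS](addr0 0) -{1}e1 -e2; ring.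
  split=> //; apply: (mulIf rn0).
  by rewrite mul0r -[RHS]e1 s0' add0r.
have vanish t : (forall v, (z3 R).@[v] != 0 -> d.@[v] != 0 -> t.@[v] = 0) ->
    t = 0.
  move=> t0; have /eqP : t * (z3 R * d) = 0.
    apply: mpoly_eq0_meval => v; rewrite !mevalM.
    have [->|z3v] := eqVneq ((z3 R).@[v]) 0; first by rewrite mul0r mulr0.
    have [->|dv] := eqVneq (d.@[v]) 0; first by rewrite !mulr0.
    by rewrite t0 ?mul0r.
  by rewrite !mulf_eq0 (negPf z3n0) (negPf dn0) !orbF => /eqP.
apply/polyP => -[|[|j]]; rewrite coef0.
- by apply: vanish => v z3v dv; case: (s01 v z3v dv).
- by apply: vanish => v z3v dv; case: (s01 v z3v dv).
- by rewrite nth_default // (leq_trans _ (isT : 2 <= j.+2)%N).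
Qed.

(** * Characteristic polynomials and eigenvalues of h *)

Lemma sl2_bracket_he1 (R : realType) :
  lie_bracket (sl2_h R) (sl2_e1 R) = 2 *: sl2_e1 R.
Proof.
apply: val_inj; rewrite [RHS]linearZ /= /commutator mulmxBl mulmxBr.
rewrite !mul_delta_mx_cond !eqE /= ?mulr1n ?mulr0n.
by rewrite subr0 sub0r opprK scaler_nat.
Qed.

Lemma sl2_bracket_he2 (R : realType) :
  lie_bracket (sl2_h R) (sl2_e2 R) = - 2 *: sl2_e2 R.
Proof.
apply: val_inj; rewrite [RHS]linearZ /= /commutator mulmxBl mulmxBr.
rewrite !mul_delta_mx_cond !eqE /= ?mulr1n ?mulr0n.
by rewrite subr0 sub0r scaleNr scaler_nat mulr2n opprD.
Qed.

Lemma sl2_bracket_e1e2 (R : realType) :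
  lie_bracket (sl2_e1 R) (sl2_e2 R) = sl2_h R.
Proof.
by apply: val_inj; rewrite /= /commutator !mul_delta_mx_cond !eqE /= !mulr1n.
Qed.

Lemma det_scalarD_char_poly (K : fieldType) n (H : 'M[K]_n) alpha c r :
  r != 0 -> char_poly H = \prod_(a <- alpha) ('X - a%:P) ->
  \det (c%:M + r *: H) = \prod_(a <- alpha) (c + a * r).
Proof.
move=> rn0 chH.
(* Factoring out - r from the matrix gives (- r) ^+ n, which is shared among
   the factors: there are as many of them as rows. *)
have szn : size alpha = n.
  by apply: succn_inj; rewrite -(size_char_poly H) chH size_prod_XsubC.
have -> : c%:M + r *: H = - r *: ((- c / r)%:M - H).
  apply/matrixP=> i j; rewrite !mxE -mulr_natr.
  by case: (_ == _) => /=; field.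
rewrite detZ -[n in _ ^+ n]szn.
have -> : \det ((- c / r)%:M - H) = (char_poly H).[- c / r].
  rewrite -horner_evalE -det_map_mx; congr (\det _).
  apply/matrixP=> i j; rewrite !mxE /= horner_evalE !hornerE.
  by case: (_ == _); rewrite !hornerE.
rewrite chH horner_prod -count_predT -iter_mulr_1 -big_const_seq -big_split /=.
by apply: eq_bigr => a _; rewrite !hornerE; field.
Qed.

Lemma rep_char_poly_pencil (R : realType) n (phi : sl2_rep R n) :
  rep_char_poly phi = \det (pencil (map_mx (@mpolyC 4 R[i]) (phi (sl2_h R)))
    (map_mx (@mpolyC 4 R[i]) (phi (sl2_e1 R)))
    (map_mx (@mpolyC 4 R[i]) (phi (sl2_e2 R))) (z0 R) (z1 R) (z2 R) (z3 R)).
Proof. by []. Qed.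

Lemma meval_rep_char_poly (R : realType) n (phi : sl2_rep R n) v :
  (rep_char_poly phi).@[v] = \det (pencil (phi (sl2_h R)) (phi (sl2_e1 R))
    (phi (sl2_e2 R)) (z0 R).@[v] (z1 R).@[v] (z2 R).@[v] (z3 R).@[v]).
Proof.
have evalC (X : 'M[R[i]]_n) : map_mx (meval v) (map_mx (@mpolyC 4 R[i]) X) = X.
  by apply/matrixP=> i j; rewrite !mxE mevalC.
by rewrite rep_char_poly_pencil -det_map_mx map_pencil !evalC.
Qed.

(** At a point of the double cover lying over generic values of the variables,
    the left side becomes det (z0 + s phi(h)) by straightening the pencil. *)
Lemma embed_rep_char_poly (R : realType) n (phi : sl2_rep R n) alpha :
  char_poly (phi (sl2_h R)) = \prod_(a <- alpha) ('X - a%:P) ->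
  sqrt_ring_embed (rep_char_poly phi) = \prod_(a <- alpha) linear_factor a.
Proof.
move=> chH.
transitivity (in_qpoly (sqrt_modulus R)
    (\prod_(a <- alpha) ((z0 R)%:P + (a%:MP)%:P * 'X))); last first.
  rewrite rmorph_prod; apply: eq_bigr => a _.
  by rewrite rmorphD rmorphM.
apply: sqrt_ring_separated => v r z3n0 rn0 rE.
rewrite map_polyC hornerC /= meval_rep_char_poly.
rewrite (det_pencil_straighten _ _ _ _ z3n0 rn0).
- rewrite (det_scalarD_char_poly _ rn0 chH) rmorph_prod horner_prod.
  apply: eq_bigr => a _.
  by rewrite rmorphD rmorphM /= !map_polyC map_polyX !hornerE /= mevalC.
- by rewrite -[LHS]rep_bracket sl2_bracket_he1 linearZ.
- by rewrite -[LHS]rep_bracket sl2_bracket_he2 linearZ.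
- by rewrite -[LHS]rep_bracket sl2_bracket_e1e2.
- by rewrite rE mevalD rmorphXn mevalM.
Qed.

(** Substituting (X, -1, 0, 0) for the variables gives det (X - phi(h)). *)
Lemma char_poly_of_rep_char_poly (R : realType) n m
    (phi : sl2_rep R n) (psi : sl2_rep R m) :
  rep_char_poly phi = rep_char_poly psi ->
  char_poly (phi (sl2_h R)) = char_poly (psi (sl2_h R)).
Proof.
pose h (i : 'I_4) : {poly R[i]} :=
  if i == 0 :> nat then 'X else if i == 1 :> nat then - 1 else 0.
suff spec k (chi : sl2_rep R k) :
    mmap polyC h (rep_char_poly chi) = char_poly (chi (sl2_h R)).
  by rewrite -!spec => ->.
rewrite rep_char_poly_pencil -[LHS]det_map_mx map_pencil.
rewrite /z0 /z1 /z2 /z3 /= !mmapX !mmap1U /h /= /pencil !scale0r !addr0.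
congr (\det _); apply/matrixP=> i j.
by rewrite !mxE mmapC mulN1r.
Qed.

(** * Spectra of Kronecker sums *)

Section KroneckerSum.
Variables (K : comNzRingType) (n m : nat).
Implicit Types (A : 'M[K]_n) (B : 'M[K]_m).

(** The action of a Lie algebra element on a tensor product. *)
Definition kronecker_sum A B : 'M[K]_(n * m) := tensmx A 1%:M + tensmx 1%:M B.

Lemma kronecker_sumE A B i j k l :
  kronecker_sum A B (mxtens_index (i, j)) (mxtens_index (k, l)) =
  A i k *+ (j == l) + B j l *+ (i == k).
Proof. by rewrite mxE !tensmxE !mxE mulr_natr mulr_natl. Qed.

Lemma kronecker_sumP c A A' B B' :
  kronecker_sum (c *: A + A') (c *: B + B') =
  c *: kronecker_sum A B + kronecker_sum A' B'.
Proof. by apply/matrixP => u v; rewrite !mxE; ring. Qed.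

Lemma kronecker_sum_intertwine A A' B B' P Q :
    P *m A = A' *m P -> Q *m B = B' *m Q ->
  tensmx P Q *m kronecker_sum A B = kronecker_sum A' B' *m tensmx P Q.
Proof.
move=> PA QB; rewrite mulmxDr mulmxDl !tensmx_mul !mulmx1 !mul1mx.
by rewrite PA QB.
Qed.

Lemma kronecker_sum_commutator A A' B B' :
  kronecker_sum A B *m kronecker_sum A' B'
    - kronecker_sum A' B' *m kronecker_sum A B =
  kronecker_sum (A *m A' - A' *m A) (B *m B' - B' *m B).
Proof.
rewrite /kronecker_sum !mulmxDl !mulmxDr !tensmx_mul !mul1mx !mulmx1.
by apply/matrixP=> i j; rewrite ![in LHS]mxE ![in RHS]mxE; ring.
Qed.

(** The pairs (i, j) are numbered lexicographically by i * m + j. *)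
Lemma kronecker_sum_trig A B :
  is_trig_mx A -> is_trig_mx B -> is_trig_mx (kronecker_sum A B).
Proof.
move=> /is_trig_mxP trA /is_trig_mxP trB; apply/is_trig_mxP => u v.
case: (mxtens_indexP u) => i j; case: (mxtens_indexP v) => k l /= lt_uv.
rewrite kronecker_sumE; have [ltik|ltki|/val_inj eik] := ltngtP i k.
- by rewrite trA // mul0rn add0r -val_eqE /= ltn_eqF.
(* If k < i, then the index of (k, l) would be the smaller one. *)
- have : (k * m + l < i * m + j)%N.
    apply: (@leq_trans (k.+1 * m)).
      by rewrite mulSn addnC ltn_add2r.
    exact: leq_trans (leq_mul _ _) (leq_addr _ _).
  by rewrite ltnNge ltnW.
- move: lt_uv; rewrite eik ltn_add2l => ltjl.
  by rewrite trB // mul0rn addr0 -val_eqE /= ltn_eqF.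
Qed.

Lemma big_mxtens (T : Type) (idx : T) (op : Monoid.com_law idx)
    (F : 'I_(n * m) -> T) :
  \big[op/idx]_k F k =
  \big[op/idx]_(i < n) \big[op/idx]_(j < m) F (mxtens_index (i, j)).
Proof.
rewrite pair_big /= (reindex (@mxtens_index n m)).
  by apply: eq_bigr => -[i j].
by exists (@mxtens_unindex n m) => ? _;
   rewrite (mxtens_indexK, mxtens_unindexK).
Qed.

Lemma tensmx1 : tensmx 1%:M 1%:M = 1%:M :> 'M[K]_(n * m).
Proof.
apply/matrixP=> u v; case: (mxtens_indexP u) => i j.
case: (mxtens_indexP v) => k l; rewrite tensmxE !mxE -natrM mulnb.
by rewrite (can_eq (@mxtens_indexK n m)) xpair_eqE.
Qed.

End KroneckerSum.

Lemma char_poly_intertwine (K : fieldType) n (P A B : 'M[K]_n) :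
  P \in unitmx -> P *m A = B *m P -> char_poly A = char_poly B.
Proof.
move=> uP PA; have detP : (\det P)%:P != 0.
  by rewrite polyC_eq0 -unitfE -unitmxE.
apply: (mulfI detP); rewrite [RHS]mulrC -det_map_mx -!det_mulmx.
congr (\det _); rewrite /char_poly_mx mulmxBr mulmxBl -!map_mxM PA.
by rewrite scalar_mxC.
Qed.

Lemma trigonalizable (K : numClosedFieldType) n (A : 'M[K]_n) :
  exists P T : 'M[K]_n, [/\ P \in unitmx, is_trig_mx T & P *m A = T *m P].
Proof.
have [|P uP] := @cotrigonalization K n [:: A].
  by move=> B C /[!inE] /eqP -> /eqP ->.
rewrite /= andbT => trA; have {}uP := unitarymx_unit uP.
exists P, (conjmx P A); split => //.
by rewrite conjumx // mulmxKV.
Qed.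

(** Triangularizing A and B triangularizes their Kronecker sum, whose diagonal
    consists of the sums of the diagonal entries. *)
Lemma char_poly_kronecker_sum (K : numClosedFieldType) n m
    (A : 'M[K]_n) (B : 'M[K]_m) alpha beta :
    char_poly A = \prod_(a <- alpha) ('X - a%:P) ->
    char_poly B = \prod_(b <- beta) ('X - b%:P) ->
  char_poly (kronecker_sum A B) =
  \prod_(a <- alpha) \prod_(b <- beta) ('X - (a + b)%:P).
Proof.
have [P [T [uP trT PA]]] := trigonalizable A.
have [Q [S [uQ trS QB]]] := trigonalizable B.
have uPQ : tensmx P Q \in unitmx.
  suff /mulmx1_unit[] : tensmx P Q *m tensmx (invmx P) (invmx Q) = 1%:M by [].
  by rewrite tensmx_mul !mulmxV // tensmx1.
rewrite (char_poly_intertwine uP PA) (char_poly_intertwine uQ QB).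
rewrite (char_poly_intertwine uPQ (kronecker_sum_intertwine PA QB)).
rewrite !char_poly_trig ?kronecker_sum_trig //.
rewrite -(big_map (fun i => T i i) xpredT (fun a => 'X - a%:P)).
rewrite -(big_map (fun i => S i i) xpredT (fun a => 'X - a%:P)).
move=> /prod_XsubC_eq pT /prod_XsubC_eq pS; rewrite big_mxtens.
rewrite -(perm_big _ pT) big_map /=; apply: eq_bigr => i _.
rewrite -(perm_big _ pS) big_map /=; apply: eq_bigr => j _.
by rewrite kronecker_sumE !eqxx.
Qed.

(** * Tensor products and the trivial representation *)

Section TensorRep.
Variables (R : realType) (n m : nat) (phi : sl2_rep R n) (psi : sl2_rep R m).

Definition tensor_rep_map x := kronecker_sum (phi x) (psi x).

Fact tensor_rep_map_linear : linear tensor_rep_map.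
Proof.
by move=> c x y; rewrite /tensor_rep_map !linearP kronecker_sumP.
Qed.

HB.instance Definition _ := GRing.isLinear.Build R[i] (sl2 R) 'M[R[i]]_(n * m)
  _ tensor_rep_map tensor_rep_map_linear.

Fact tensor_rep_bracket x y :
  tensor_rep_map (lie_bracket x y) =
  commutator (tensor_rep_map x) (tensor_rep_map y).
Proof.
by rewrite /tensor_rep_map !rep_bracket -kronecker_sum_commutator.
Qed.

Definition tensor_rep : sl2_rep R (n * m) := Sl2Rep tensor_rep_bracket.

End TensorRep.

Fact trivial_rep_bracket (R : realType) (x y : sl2 R) :
  (\0 : {linear sl2 R -> 'M[R[i]]_1}) (lie_bracket x y) =
  commutator ((\0 : {linear sl2 R -> 'M[R[i]]_1}) x)
             ((\0 : {linear sl2 R -> 'M[R[i]]_1}) y).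
Proof. by rewrite /= /commutator mulmx0 subrr. Qed.

Definition trivial_rep (R : realType) : sl2_rep R 1 :=
  Sl2Rep (@trivial_rep_bracket R).

Lemma rep_char_poly_trivial (R : realType) :
  rep_char_poly (trivial_rep R) = z0 R.
Proof.
by rewrite rep_char_poly_pencil /pencil /= !map_mx0 !scaler0 !addr0 det_scalar1.
Qed.

Lemma char_poly_trivial_h (R : realType) :
  char_poly (trivial_rep R (sl2_h R)) = \prod_(a <- [:: 0]) ('X - a%:P).
Proof.
by rewrite big_seq1 /= /char_poly /char_poly_mx map_mx0 subr0 det_scalar1 subr0.
Qed.

(** * The monoid of characteristic polynomials *)

Lemma sqrt_ring_embed_inj (R : realType) : injective (@sqrt_ring_embed R).
Proof.
move=> f g /(congr1 val) /=.
rewrite !Pdiv.Ring.rmodp_small ?mk_monic_sqrt_modulus.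
- exact: polyC_inj.
- by rewrite size_XnsubC // (leq_ltn_trans (size_polyC_leq1 _)).
- by rewrite size_XnsubC // (leq_ltn_trans (size_polyC_leq1 _)).
Qed.

Lemma rep_resolution (R : realType) n (phi : sl2_rep R n) alpha :
  char_poly (phi (sl2_h R)) = \prod_(a <- alpha) ('X - a%:P) ->
  resolution (rep_char_poly phi) alpha.
Proof.
by move=> chH; exists n, phi; split=> //; exact: embed_rep_char_poly.
Qed.

(** The definition of a resolution provides some representation with the given
    characteristic polynomial; every other one has the same eigenvalues. *)
Lemma resolution_char_poly (R : realType) n (phi : sl2_rep R n) alpha :
  resolution (rep_char_poly phi) alpha ->
  char_poly (phi (sl2_h R)) = \prod_(a <- alpha) ('X - a%:P).
Proof.
by case=> m [psi [/char_poly_of_rep_char_poly -> -> _]].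
Qed.

Lemma resolution_exists (R : realType) (f : CP R) :
  exists alpha, resolution (val f) alpha.
Proof.
have [n [phi ->]] := set_mem (valP f).
have [alpha chE] := closed_field_poly_normal (char_poly (phi (sl2_h R))).
exists alpha; apply: rep_resolution.
by rewrite {1}chE (monicP (char_poly_monic _)) scale1r.
Qed.

(** Equations in the monoid are checked on spectra, inside the extension by the
    square root. *)
Lemma resolution_eq (R : realType) (f g : CP R) alpha beta :
    resolution (val f) alpha -> resolution (val g) beta ->
    \prod_(a <- alpha) linear_factor a = \prod_(b <- beta) linear_factor b ->
  f = g.
Proof.
move=> [n [phi [_ _ fE]]] [m [psi [_ _ gE]]] E.
by apply/val_inj/sqrt_ring_embed_inj; rewrite fE gE.
Qed.

Definition CP_of_rep (R : realType) n (phi : sl2_rep R n) : CP R :=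
  exist _ (rep_char_poly phi) (mem_set (ex_intro _ n (ex_intro _ phi erefl))).

Lemma tensor_resolution (R : realType) n m (phi : sl2_rep R n)
    (psi : sl2_rep R m) alpha beta :
    resolution (rep_char_poly phi) alpha ->
    resolution (rep_char_poly psi) beta ->
  resolution (rep_char_poly (tensor_rep phi psi))
    [seq a + b | a <- alpha, b <- beta].
Proof.
move=> /resolution_char_poly ch1 /resolution_char_poly ch2.
apply: rep_resolution; rewrite big_allpairs_dep.
exact: char_poly_kronecker_sum.
Qed.

Lemma resolution_product_exists (R : realType) :
  exists op : CP R -> CP R -> CP R, forall f g alpha beta,
    resolution (val f) alpha -> resolution (val g) beta ->
    resolution (val (op f g)) [seq a + b | a <- alpha, b <- beta].
Proof.
have rep (f : CP R) : {n & {phi : sl2_rep R n | val f = rep_char_poly phi}}.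
  have /cid[n /cid[phi fE]] := set_mem (valP f).
  by exists n, phi.
exists (fun f g => CP_of_rep
  (tensor_rep (sval (projT2 (rep f))) (sval (projT2 (rep g))))).
move=> f g alpha beta.
case: (rep f) (rep g) => [n [phi fE]] [m [psi gE]] /=.
by rewrite fE gE; exact: tensor_resolution.
Qed.

Theorem theorem5p3 (R : realType) :
  exists (e : CP R) (op : Monoid.com_law e),
    val e = z0 R /\
    (forall (f g : CP R) (p : sqrt_ring R),
       is_resolution_product (val f) (val g) p <->
       p = sqrt_ring_embed (val (op f g))).
Proof.
have [op op_res] := resolution_product_exists R.
pose e := CP_of_rep (trivial_rep R).
have e_res : resolution (val e) [:: 0].
  exact/rep_resolution/char_poly_trivial_h.
have opA : associative op.
  move=> f g h; have [alpha fa] := resolution_exists f.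
  have [beta gb] := resolution_exists g; have [gamma hc] := resolution_exists h.
  apply: resolution_eq (op_res _ _ _ _ fa (op_res _ _ _ _ gb hc))
    (op_res _ _ _ _ (op_res _ _ _ _ fa gb) hc) _.
  rewrite !big_allpairs_dep; apply: eq_bigr => a _.
  rewrite !big_allpairs_dep; apply: eq_bigr => b _.
  by apply: eq_bigr => c _; rewrite addrA.
have opC : commutative op.
  move=> f g; have [alpha fa] := resolution_exists f.
  have [beta gb] := resolution_exists g.
  apply: resolution_eq (op_res _ _ _ _ fa gb) (op_res _ _ _ _ gb fa) _.
  rewrite !big_allpairs_dep exchange_big; apply: eq_bigr => b _.
  by apply: eq_bigr => a _; rewrite addrC.
have op1 : left_id e op.
  move=> f; have [alpha fa] := resolution_exists f.
  apply: resolution_eq (op_res _ _ _ _ e_res fa) fa _.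
  by rewrite big_allpairs_dep big_seq1; apply: eq_bigr => a _; rewrite add0r.
pose opM := Monoid.isComLaw.Build _ e op opA opC op1.
exists e, (HB.pack_for (Monoid.com_law e) op opM).
split=> [|f g p]; first exact: rep_char_poly_trivial.
split=> [[alpha [beta [fa gb ->]]]|->] /=.
  by have [n [phi [_ _ ->]]] := op_res _ _ _ _ fa gb; rewrite big_allpairs_dep.
have [alpha fa] := resolution_exists f; have [beta gb] := resolution_exists g.
exists alpha, beta; split=> //.
by have [n [phi [_ _ ->]]] := op_res _ _ _ _ fa gb; rewrite big_allpairs_dep.
Qed.
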